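(* Let $G$ be a finite simple graph and $k$ a positive integer. If $r\in R_{\max}(G,k)$, then $r$ is a proper restraint, i.e. $r(u)\cap r(v)=\emptyset$ for every edge $uv\in E(G)$.
   Context: A restraint $r$ on a graph $G$ assigns to each vertex $v$ a finite set $r(v)\subset\mathbb{N}$ of forbidden colours; a proper $x$-colouring $c$ of $G$ is permitted by $r$ if $c(v)\notin r(v)$ for all $v$, and $\pi_r(G,x)$ denotes the number of proper $x$-colourings permitted by $r$. If $G$ has $n$ vertices, a $k$-restraint is a restraint with $|r(v)|=k$ and $r(v)\subseteq\{1,2,\dots,kn\}$ for every vertex $v$. $R_{\max}(G,k)$ is the set of $k$-restraints $r$ on $G$ such that for every $k$-restraint $r'$ on $G$, $\pi_r(G,x)\geq\pi_{r'}(G,x)$ for all sufficiently large $x$. *)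

(* Defs.v *)
From mathcomp Require Import all_boot finmap.

Set Implicit Arguments.
Unset Strict Implicit.
Unset Printing Implicit Defensive.

Local Open Scope fset_scope.

(* A simple graph is a finType of vertices T with a symmetric irreflexive
   adjacency relation e; both properties are hypotheses where needed. *)

Definition restraint (T : finType) := T -> {fset nat}.

(* The colours 1, ..., x are encoded by 'I_x: the element i stands for
   the colour i.+1. *)
Definition colour (x : nat) (i : 'I_x) : nat := i.+1.

Definition proper_colouring (T : finType) (e : rel T) (x : nat)
    (c : {ffun T -> 'I_x}) : bool :=
  [forall u, forall v, e u v ==> (c u != c v)].

Definition permitted (T : finType) (r : restraint T) (x : nat)
    (c : {ffun T -> 'I_x}) : bool :=
  [forall v, colour (c v) \notin r v].

Definition restrained_chrom (T : finType) (e : rel T) (r : restraint T)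
    (x : nat) : nat :=
  #|[set c : {ffun T -> 'I_x} | proper_colouring e c & permitted r c]|.

Definition k_restraint (T : finType) (k : nat) (r : restraint T) : Prop :=
  forall v, #|` r v| = k /\ (forall i, i \in r v -> 1 <= i <= k * #|T|).

Definition Rmax (T : finType) (e : rel T) (k : nat) (r : restraint T) : Prop :=
  k_restraint k r /\
  forall r' : restraint T, k_restraint k r' ->
    exists N : nat, forall x : nat, N <= x ->
      restrained_chrom e r' x <= restrained_chrom e r x.

Definition proper_restraint (T : finType) (e : rel T) (r : restraint T) : Prop :=
  forall u v, e u v -> r u `&` r v = fset0.

(* Main.v *)
Require Import Defs.
From mathcomp Require Import all_boot finmap.
From mathcomp Require Import zify.

(** Let [n] be the number of vertices, [K = k * n] and [x = K + m].  Call the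
colours [1, ..., K] low; only these can be forbidden.  Sorting the colourings
by their restriction [h] to the vertices with a high colour, [pi_r (G, x)] is
the sum over the proper partial colourings [h] with [m] colours of the number of
permitted proper low colourings of the set [S] of vertices left out by [h].
For [#|S| <= 2] that number is maximised by a restraint with pairwise disjoint
values, and strictly so when [S] is an edge [uv] with [r u] and [r v] meeting.
There are of order [m ^ (n - 2)] partial colourings [h] leaving out [u] and [v],
but only [O(m ^ (n - 3))] leaving out three or more vertices, so for large [m] a
restraint with a conflict on an edge loses to the pairwise disjoint one. *)

Set Implicit Arguments.
Unset Strict Implicit.
Unset Printing Implicit Defensive.

(** * Counting partial colourings by their set of uncoloured vertices *)

Section PartialColourings.

Variables (T X : finType) (e : rel T).

Definition partial_proper (a : {ffun T -> option X}) : bool :=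
  [forall u, forall v, e u v ==> (a u == a v) ==> (a u == None)].

Definition holes (a : {ffun T -> option X}) : {set T} :=
  [set v | a v == None].

Definition partial_lists (A : T -> {set X}) (S : {set T}) :
    {set {ffun T -> option X}} :=
  [set a : {ffun T -> option X} |
    [forall v, if a v is Some i then (v \in S) && (i \in A v) else v \notin S]].

Lemma partial_properP (a : {ffun T -> option X}) :
  reflect (forall u v, e u v -> a u = a v -> a u = None) (partial_proper a).
Proof.
apply: (iffP forallP) => [H u v euv auv | H u].
  by move/forallP/(_ v): (H u); rewrite euv auv eqxx => /eqP.
apply/forallP => v; apply/implyP => euv; apply/implyP => /eqP auv.
exact/eqP/(H _ v).
Qed.

Lemma partial_listsP (A : T -> {set X}) (S : {set T}) (a : {ffun T -> option X}) :
  reflect (forall v, if a v is Some i then (v \in S) && (i \in A v)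
                     else v \notin S)
          (a \in partial_lists A S).
Proof. by rewrite inE; apply: forallP. Qed.

(** The values at different vertices are chosen independently; a vertex outside [S] has the single
    choice [None] and contributes a factor 1. *)
Lemma card_partial_lists (A : T -> {set X}) (S : {set T}) :
  #|partial_lists A S| = \prod_(v in S) #|A v|.
Proof.
pose F v : pred (option X) :=
  fun o => if o is Some i then (v \in S) && (i \in A v) else v \notin S.
have -> : #|partial_lists A S| = #|family F|.
  by apply: eq_card => a; rewrite inE; apply/forallP/familyP.
rewrite card_family foldrE big_map enumT [RHS]big_mkcond /=.
apply: eq_bigr => v _; case: ifP => vS.
  rewrite -(card_imset _ (@Some_inj _)); apply: eq_card => -[i|] /=.
    rewrite mem_imset; last exact: Some_inj.
    by rewrite unfold_in /= vS.
  rewrite unfold_in /= vS /=; symmetry; apply/imsetP => -[] //.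
rewrite -(card1 (None : option X)); apply: eq_card => -[i|].
  by rewrite unfold_in /= vS.
by rewrite unfold_in /= vS.
Qed.

Lemma holes_partial_lists (S : {set T}) (a : {ffun T -> option X}) :
  (holes a == S) = (a \in partial_lists (fun=> setT) (~: S)).
Proof.
apply/eqP/partial_listsP => [<- v | H].
  by case av: (a v) => [i|]; rewrite !inE av.
apply/setP => v; move: (H v); rewrite [v \in holes a]inE.
case: (a v) => [i|]; rewrite !inE ?andbT ?negbK; last by move=> ->.
by move=> /negbTE ->.
Qed.

Lemma card_holes_eq (S : {set T}) :
  #|[set a : {ffun T -> option X} | holes a == S]| = #|X| ^ (#|T| - #|S|).
Proof.
have -> : [set a : {ffun T -> option X} | holes a == S] = partial_lists (fun=> setT) (~: S).
  by apply/setP => a; rewrite inE holes_partial_lists.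
by rewrite card_partial_lists prod_nat_const cardsT cardsCs setCK.
Qed.

(** Grouping by hole set gives at most [2 ^ #|T|] classes, and three or more holes leave at most
    [#|T| - 3] free vertices. The factor [#|X|] on the left avoids a truncated exponent
    [#|T| - 3]. *)
Lemma card_holes_gt2 :
  #|X| * #|[set a : {ffun T -> option X} | 2 < #|holes a|]|
    <= 2 ^ #|T| * #|X| ^ (#|T| - 2).
Proof.
have [->|X_gt0] := posnP #|X|; first by [].
rewrite -sum1dep_card (partition_big (@holes) predT) //= big_distrr /=.
rewrite -[in 2 ^ _]cardsT -card_powerset powersetT cardsT -sum_nat_const.
apply: leq_sum => S _; rewrite sum1dep_card.
have [S_gt2|S_le2] := ltnP 2 #|S|; last first.
  rewrite (_ : [set _ | _] = set0) ?cards0 ?muln0 //.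
  apply/setP => a; rewrite !inE; apply/negP => /andP[lt2 /eqP hS].
  by rewrite hS ltnNge S_le2 in lt2.
apply: (@leq_trans (#|X| * #|X| ^ (#|T| - #|S|))).
  rewrite leq_mul2l -card_holes_eq subset_leq_card ?orbT //.
  by apply/subsetP => a; rewrite !inE => /andP[].
have ST : #|S| <= #|T| := max_card _.
rewrite -expnS leq_pexp2l //; move: S_gt2 ST; move: (#|S|) (#|T|); lia.
Qed.

(* Injective colourings of the complement of [S] are proper whatever [e] is. *)
Lemma card_proper_holes_ge (S : {set T}) : irreflexive e ->
  #|X| ^_ (#|T| - #|S|)
    <= #|[set a : {ffun T -> option X} | partial_proper a & holes a == S]|.
Proof.
move=> e_irr; pose D : finType := {v : T | v \notin S}.
(* [insub v] is [None] exactly for [v] in [S], so [ext g] has hole set [S]. *)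
pose ext (g : {ffun D -> X}) : {ffun T -> option X} :=
  [ffun v => omap g (insub v)].
have extE g (d : D) : ext g (val d) = Some (g d) by rewrite ffunE valK.
have ext_inj : injective ext.
  move=> f g fg; apply/ffunP => d; apply: Some_inj.
  by rewrite -!extE fg.
have <- : #|D| = #|T| - #|S|.
  rewrite card_sig -(cardsC S) addKn.
  by apply: eq_card => x; rewrite !inE.
rewrite -card_inj_ffuns -(card_imset _ ext_inj) subset_leq_card //.
apply/subsetP => h /imsetP[g]; rewrite inE => /injectiveP g_inj ->.
rewrite inE; apply/andP; split; last first.
  apply/eqP/setP => v; rewrite inE ffunE; case: insubP => [d /negbTE -> _ //|].
  by rewrite negbK => ->.
apply/partial_properP => u v euv; rewrite !ffunE.
case: insubP => [du _ duE|] //; case: insubP => [dv _ dvE|] //= [] /g_inj dd.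
by move: euv; rewrite -duE -dvE dd e_irr.
Qed.

End PartialColourings.

(** * Low colourings of at most two vertices *)

Lemma card_ord_notin (K : nat) (A : {fset nat}) :
  (forall i, i \in A -> 1 <= i <= K) ->
  #|[set i : 'I_K | colour i \notin A]| = K - #|` A|.
Proof.
move=> AK; pose B := [set i : 'I_K | colour i \in A].
have cB : #|B| = #|` A|.
  rewrite cardE -(size_map (@colour K)); apply/perm_size/uniq_perm; [|exact: fset_uniq|].
    by rewrite map_inj_uniq ?enum_uniq // => i j [] /val_inj.
  move=> i; apply/mapP/idP => [[j]|iA]; first by rewrite mem_enum inE => jA ->.
  have /andP[i_gt0 iK] := AK i iA; have iK' : i.-1 < K by lia.
  by exists (Ordinal iK'); rewrite ?mem_enum ?inE /colour /= prednK.
have := cardsC B; rewrite cB card_ord => KE.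
rewrite -[X in X - _]KE addKn.
by apply: eq_card => i; rewrite !inE.
Qed.

Section LowColours.

Variables (T : finType) (e : rel T) (k : nat).
Let K := k * #|T|.

Definition allowed_low (r : restraint T) (v : T) : {set 'I_K} :=
  [set i : 'I_K | colour i \notin r v].

Definition low_colourings (r : restraint T) (S : {set T}) :=
  [set a : {ffun T -> option 'I_K} | partial_proper e a & a \in partial_lists (allowed_low r) S].

Lemma card_allowed_low (r : restraint T) (v : T) :
  k_restraint k r -> #|allowed_low r v| = K - k.
Proof. by move=> /(_ v) [kv rK]; rewrite card_ord_notin ?kv. Qed.

Lemma card_allowed_low2 (r : restraint T) (u v : T) :
  k_restraint k r ->
  #|allowed_low r u :&: allowed_low r v| = K - #|` (r u `|` r v)%fset|.
Proof.
move=> kr; rewrite -card_ord_notin.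
  by apply: eq_card => i; rewrite !inE negb_or.
by move=> i; rewrite inE => /orP[]; apply: (kr _).2.
Qed.

(** With no edge inside [S], properness is automatic and only the list sizes matter, so every
    [k]-restraint gives the same count. *)
Lemma card_low_colourings_indep (r : restraint T) (S : {set T}) :
  k_restraint k r -> {in S &, forall u v, ~~ e u v} ->
  #|low_colourings r S| = (K - k) ^ #|S|.
Proof.
move=> kr Sind; rewrite -prod_nat_const.
rewrite -(eq_bigr _ (fun v _ => card_allowed_low v kr)) -card_partial_lists.
apply: eq_card => a; rewrite inE andb_idl // => /partial_listsP aP.
apply/partial_properP => u v euv auv; move: (aP u) (aP v); rewrite -auv.
by case: (a u) => // i /andP[uS _] /andP[vS _]; have := Sind u v uS vS; rewrite euv.
Qed.

(** Among the [(K - k) ^ 2] list colourings of [u] and [v], the improper ones are the monochromatic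
    ones, whose colour avoids both [r u] and [r v]. The additive form avoids a truncated
    subtraction. *)
Lemma card_low_colourings_edge (r : restraint T) (u v : T) :
  irreflexive e -> k_restraint k r -> e u v ->
  #|low_colourings r [set u; v]| + (K - #|` (r u `|` r v)%fset|) = (K - k) ^ 2.
Proof.
move=> e_irr kr euv; have uv : u != v by apply: contraTneq euv => ->; rewrite e_irr.
set S := [set u; v]; have <- : #|S| = 2 by rewrite cards2 uv.
rewrite -prod_nat_const -(eq_bigr _ (fun v _ => card_allowed_low v kr)).
rewrite -card_partial_lists -card_allowed_low2 //.
pose mono (i : 'I_K) : {ffun T -> option 'I_K} :=
  [ffun w => if w \in S then Some i else None].
have mono_inj : injective mono.
  by move=> i j /ffunP/(_ u); rewrite !ffunE !inE eqxx => -[].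
rewrite -(card_imset _ mono_inj).
set L := partial_lists _ _; set M := imset _ _.
have -> : low_colourings r S = L :\: M.
  apply/setP => a; rewrite !inE [RHS]andbC [LHS]andbC.
  case aL: (a \in L); move: (aL); rewrite inE => -> //=.
  move/partial_listsP: aL => aP; apply/partial_properP/idP => [ap|aM x y exy axy].
    apply/imsetP => -[i _ aE]; have := ap u v euv.
    by rewrite aE !ffunE !inE !eqxx orbT => /(_ erefl).
  case ax: (a x) => [i|//]; case/imsetP: aM.
  move: (aP x) (aP y); rewrite -axy ax => /andP[xS ix] /andP[yS iy].
  have xy : x != y by apply: contraTneq exy => ->; rewrite e_irr.
  have aw w : w \in S -> a w = Some i /\ i \in allowed_low r w.
    move=> wS; have [->//|->] : w = x \/ w = y; last by rewrite -axy.
    move: wS xS yS xy; rewrite !inE.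
    by do 3![case/orP => /eqP ->]; rewrite ?eqxx; auto.
  exists i.
    rewrite inE; by apply/andP; split; apply: (aw _ _).2; rewrite !inE eqxx ?orbT.
  apply/ffunP => w; rewrite ffunE; case: ifP => [/aw[]//|wS].
  by move: (aP w); rewrite wS; case: (a w).
have ML : M \subset L.
  apply/subsetP => h /imsetP[i]; rewrite inE => /andP[iu iv] ->.
  apply/partial_listsP => w; rewrite ffunE; case: ifP => //=.
  by rewrite in_set2 => /orP[] /eqP ->.
by rewrite cardsD (setIidPr ML) subnK ?subset_leq_card.
Qed.

(** Either [S] is independent and the counts agree, or it is an edge; there disjoint restraints have
    the largest union, hence the fewest monochromatic colourings. *)
Lemma low_colourings_le (r r' : restraint T) (S : {set T}) :
    irreflexive e -> k_restraint k r -> k_restraint k r' ->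
    (forall u v, u != v -> r' u `&` r' v = fset0)%fset -> #|S| <= 2 ->
  #|low_colourings r S| <= #|low_colourings r' S|.
Proof.
move=> e_irr kr kr' disj S2.
have [/existsP[u /existsP[v /and3P[uS vS euv]]] | noedge] :=
  boolP [exists u, exists v, [&& u \in S, v \in S & e u v]].
  have uv : u != v by apply: contraTneq euv => ->; rewrite e_irr.
  have <- : [set u; v] = S.
    apply/eqP; rewrite eqEcard cards2 uv S2 andbT.
    by apply/subsetP => w; rewrite !inE => /orP[] /eqP ->.
  have := card_low_colourings_edge e_irr kr euv.
  have := card_low_colourings_edge e_irr kr' euv.
  rewrite !cardfsU disj // cardfs0 !(kr _).1 !(kr' _).1; lia.
have ind : {in S &, forall u v, ~~ e u v}.
  move=> u v uS vS; apply: contra noedge => euv.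
  by apply/existsP; exists u; apply/existsP; exists v; apply/and3P.
by rewrite !card_low_colourings_indep.
Qed.

Lemma low_colourings_lt (r r' : restraint T) (u v : T) :
    irreflexive e -> k_restraint k r -> k_restraint k r' ->
    (forall u v, u != v -> r' u `&` r' v = fset0)%fset ->
    e u v -> (r u `&` r v != fset0)%fset ->
  #|low_colourings r [set u; v]| < #|low_colourings r' [set u; v]|.
Proof.
move=> e_irr kr kr' disj euv; rewrite -cardfs_gt0.
have uv : u != v by apply: contraTneq euv => ->; rewrite e_irr.
have := card_low_colourings_edge e_irr kr euv.
have := card_low_colourings_edge e_irr kr' euv.
have := fsubset_leq_card (fsubsetIl (r u) (r v)).
(* Without this bound, truncation at 0 in [K - (k + k)] could hide the strict gain. *)
have K2 : k + k <= K.
  rewrite addnn -muln2 leq_mul2l; apply/orP; right.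
  by have := max_card [set u; v]; rewrite cards2 uv.
rewrite !cardfsU disj // cardfs0 !(kr _).1 !(kr' _).1; lia.
Qed.

End LowColours.

(** * Splitting a colouring into its low and high parts *)

Section HighColours.

Variables (K m : nat).

Definition low (c : 'I_(K + m)) : option 'I_K :=
  if split c is inl i then Some i else None.

Definition high (c : 'I_(K + m)) : option 'I_m :=
  if split c is inr j then Some j else None.

Variant low_high_spec (c : 'I_(K + m)) : option 'I_K -> option 'I_m -> Type :=
  | IsLow (i : 'I_K) of c = lshift m i : low_high_spec c (Some i) None
  | IsHigh (j : 'I_m) of c = rshift K j : low_high_spec c None (Some j).

Lemma low_highP (c : 'I_(K + m)) : low_high_spec c (low c) (high c).
Proof.
rewrite /low /high -{1}(splitK c); case: (split c) => [i|j] /=.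
  exact: IsLow.
exact: IsHigh.
Qed.

Lemma low_lshift (i : 'I_K) : low (lshift m i) = Some i.
Proof. by rewrite /low -[lshift m i]/(unsplit (inl i)) unsplitK. Qed.

Lemma high_lshift (i : 'I_K) : high (lshift m i) = None.
Proof. by rewrite /high -[lshift m i]/(unsplit (inl i)) unsplitK. Qed.

Lemma low_rshift (j : 'I_m) : low (rshift K j) = None.
Proof. by rewrite /low -[rshift K j]/(unsplit (inr j)) unsplitK. Qed.

Lemma high_rshift (j : 'I_m) : high (rshift K j) = Some j.
Proof. by rewrite /high -[rshift K j]/(unsplit (inr j)) unsplitK. Qed.

Lemma low_high_inj (c d : 'I_(K + m)) : low c = low d -> high c = high d -> c = d.
Proof.
case: (low_highP c) => i ->; case: (low_highP d) => j -> //; first by case=> ->.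
by move=> _ [->].
Qed.

End HighColours.

(** A colouring amounts to a low and a high part with complementary domains. A low colour never
    equals a high one, so properness can be tested on each part; the restraint only affects the low
    part. *)
Lemma restrained_chrom_sum (T : finType) (e : rel T) (k m : nat)
    (r : restraint T) : k_restraint k r ->
  restrained_chrom e r (k * #|T| + m) =
    \sum_(h : {ffun T -> option 'I_m} | partial_proper e h)
      #|low_colourings e k r (holes h)|.
Proof.
move=> kr; set K := k * #|T|.
pose lo (c : {ffun T -> 'I_(K + m)}) : {ffun T -> option 'I_K} :=
  [ffun v => low (c v)].
pose hi (c : {ffun T -> 'I_(K + m)}) : {ffun T -> option 'I_m} :=
  [ffun v => high (c v)].
have properE c :
    proper_colouring e c = partial_proper e (lo c) && partial_proper e (hi c).
  apply/idP/andP => [cp | [/partial_properP lp /partial_properP hp]].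
    have neq u v : e u v -> c u != c v.
      by move=> euv; move/forallP/(_ u)/forallP/(_ v)/implyP: cp; apply.
    split; apply/partial_properP => u v /neq; rewrite !ffunE.
      case: (low_highP (c u)) => i -> //; case: (low_highP (c v)) => j -> //.
      by move=> /eqP ne [ij]; case: ne; rewrite ij.
    case: (low_highP (c u)) => i -> //; case: (low_highP (c v)) => j -> //.
    by move=> /eqP ne [ij]; case: ne; rewrite ij.
  apply/forallP => u; apply/forallP => v; apply/implyP => euv; apply/eqP => cuv.
  have := lp u v euv; have := hp u v euv; rewrite !ffunE cuv.
  by case: (low_highP (c v)) => ? _ // H1 H2; [have := H2 erefl | have := H1 erefl].
have permE c :
    permitted r c = (lo c \in partial_lists (allowed_low k r) (holes (hi c))).
  apply/forallP/partial_listsP => H v; move: (H v); rewrite inE !ffunE.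
    by case: (low_highP (c v)) => i -> //; rewrite inE.
  case: (low_highP (c v)) => i -> /=; first by rewrite inE.
  move=> _; apply/negP => /(kr v).2; rewrite /colour /= -/K; lia.
rewrite /restrained_chrom -sum1dep_card (partition_big hi (partial_proper e));
  last by move=> c /andP[]; rewrite properE => /andP[].
apply: eq_bigr => h hp; rewrite sum1dep_card.
set P := finset _.
have lo_inj : {in P &, injective lo}.
  move=> c d; rewrite !inE => /andP[_ /eqP ch] /andP[_ /eqP dh] cd.
  apply/ffunP => v; apply: low_high_inj.
    by move/ffunP/(_ v): cd; rewrite !ffunE.
  by move: ch; rewrite -dh => /ffunP/(_ v); rewrite !ffunE.
rewrite -(card_in_imset lo_inj); apply: eq_card => a; apply/imsetP/idP.
  move=> [c]; rewrite inE => /andP[/andP[]]; rewrite properE permE.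
  by move=> /andP[lp _] cl /eqP <- ->; rewrite inE lp cl.
rewrite inE => /andP[ap aP].
(* Gluing [a] and [h]: at each vertex exactly one of them is defined, since the domain of [a] is the
   hole set of [h]. *)
have /fin_all_exists[c cP] :
    forall v, exists x : 'I_(K + m), low x = a v /\ high x = h v.
  move=> v; move/partial_listsP/(_ v): (aP); rewrite inE.
  case: (a v) => [i /andP[/eqP -> _]|].
    by exists (lshift m i); rewrite low_lshift high_lshift.
  case: (h v) => // j _.
  by exists (rshift K j); rewrite low_rshift high_rshift.
have loc : lo (finfun c) = a by apply/ffunP => v; rewrite !ffunE (cP v).1.
have hic : hi (finfun c) = h by apply/ffunP => v; rewrite !ffunE (cP v).2.
by exists (finfun c); rewrite // inE properE permE loc hic ap hp aP eqxx.
Qed.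

(** * The competing restraint and the comparison for large [m] *)

Lemma disjoint_k_restraint (T : finType) (k : nat) :
  exists2 r : restraint T, k_restraint k r &
    (forall u v, u != v -> r u `&` r v = fset0)%fset.
Proof.
(* The colours from 1 to [k * #|T|] are cut into consecutive blocks of length [k], one for each
   vertex. *)
exists (fun v => [fset i in iota (k * enum_rank v).+1 k]%fset).
  move=> v; split; first by rewrite card_fseq undup_id ?iota_uniq ?size_iota.
  move=> i; rewrite inE /= mem_iota => iP.
  have := ltn_ord (enum_rank v); move: iP; set t := nat_of_ord _.
  move: (#|_|) => n; nia.
move=> u v uv; apply/fsetP => i; rewrite !inE /= !mem_iota.
have : nat_of_ord (enum_rank u) != enum_rank v.
  by apply: contra uv => /eqP/val_inj/enum_rank_inj ->.
move: (nat_of_ord (enum_rank u)) (nat_of_ord (enum_rank v)) => a b.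
rewrite neq_ltn.
case/orP => lt_ab; apply/negP => iP.
  have : k * a.+1 <= k * b by rewrite leq_mul2l lt_ab orbT.
  rewrite mulnS; lia.
have : k * b.+1 <= k * a by rewrite leq_mul2l lt_ab orbT.
rewrite mulnS; lia.
Qed.

(** Each factor [m - i] with [i < n] is at least half of [m]. *)
Lemma expn_le_ffact (m n : nat) : n.*2 <= m -> m ^ n <= 2 ^ n * m ^_ n.
Proof.
move=> n2m; rewrite ffact_prod -[X in m ^ X]card_ord -[X in 2 ^ X]card_ord.
rewrite -!prod_nat_const -big_split /=.
by apply: leq_prod => i _; have := ltn_ord i; lia.
Qed.

Theorem theorem4p1 (T : finType) (e : rel T) (e_sym : symmetric e)
    (e_irr : irreflexive e) (k : nat) (k_gt0 : 0 < k) (r : restraint T)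
    (r_max : Rmax e k r) : proper_restraint e r.
Proof.
case: r_max => kr rmax u v euv; apply/eqP/contraT => conflict.
have uv : u != v by apply: contraTneq euv => ->; rewrite e_irr.
have [r' kr' disj] := disjoint_k_restraint T k.
have [N le_N] := rmax r' kr'.
set n := #|T| in le_N.
(* A crude bound, independent of [m], on the number of low colourings of any hole set. *)
pose C := #|{: {ffun T -> option 'I_(k * n)}}|.
(* [N] makes the maximality of [r] applicable, [n.*2] serves [expn_le_ffact], and [C * 4 ^ n < m]
   gives [C * B < G] below. One factor [2 ^ n] counts hole sets, the other compares powers with
   falling factorials. *)
pose m := (N + n.*2 + C * 4 ^ n).+1.
have : N <= k * n + m by rewrite /m; lia.
move/le_N; rewrite leqNgt => /negP[].
rewrite !restrained_chrom_sum //.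
pose few (h : {ffun T -> option 'I_m}) := #|holes h| <= 2.
rewrite (bigID few) [ltnRHS](bigID few) /=.
pose S0 := [set u; v].
have cS0 : #|S0| = 2 by rewrite cards2 uv.
pose G :=
  #|[set h : {ffun T -> option 'I_m} | partial_proper e h & holes h == S0]|.
pose B := #|[set h : {ffun T -> option 'I_m} | 2 < #|holes h|]|.
have n_ge2 : 2 <= n by rewrite -cS0 max_card.
have ltBG : C * B < G.
  have geG : m ^_ (n - 2) <= G.
    by have := card_proper_holes_ge 'I_m S0 e_irr; rewrite card_ord cS0.
  have leB : m * B <= 2 ^ n * m ^ (n - 2).
    by have := card_holes_gt2 T 'I_m; rewrite card_ord.
  have lem : m ^ (n - 2) <= 2 ^ n * m ^_ (n - 2).
    apply: leq_trans (expn_le_ffact _) _; first by rewrite /m; lia.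
    by rewrite leq_mul2r leq_pexp2l ?orbT // leq_subr.
  have gt0 : 0 < m ^_ (n - 2) by rewrite ffact_gt0 /m; lia.
  have m_gt0 : 0 < m by [].
  rewrite -(ltn_pmul2l m_gt0); apply: leq_trans (leq_mul (leqnn m) geG).
  apply: (@leq_ltn_trans (C * 4 ^ n * m ^_ (n - 2))); last first.
    by rewrite ltn_pmul2r // /m; lia.
  rewrite mulnCA -mulnA leq_mul2l; apply/orP; right.
  apply: leq_trans leB _; rewrite -[4]/(2 * 2) expnMn -mulnA leq_mul2l lem.
  by rewrite orbT.
have le_few :
    \sum_(h | partial_proper e h && few h)
      #|low_colourings e k r (holes h)|
    + G
    <= \sum_(h | partial_proper e h && few h)
      #|low_colourings e k r' (holes h)|.
  (* As a sum of indicators, [G] can be charged term by term: each [h] with hole set [S0] gains at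
     least 1 when [r] is replaced by [r']. *)
  have -> : G = \sum_(h | partial_proper e h && few h) (holes h == S0).
    rewrite /G -sum1dep_card big_mkcond [RHS]big_mkcond /=.
    apply: eq_bigr => h _; case: (partial_proper e h) => //=.
    by case: (holes h =P S0) => [hS|_]; rewrite /few ?hS ?cS0 ?if_same.
  rewrite -big_split /=; apply: leq_sum => h /andP[_ h_few].
  case: (holes h =P S0) => [->|_]; first by rewrite addn1; apply: low_colourings_lt.
  by rewrite addn0; apply: low_colourings_le.
have le_many :
    \sum_(h | partial_proper e h && ~~ few h)
      #|low_colourings e k r (holes h)|
    <= C * B.
  apply: (@leq_trans (\sum_(h : {ffun T -> option 'I_m} | 2 < #|holes h|) C)).
    rewrite big_mkcond [leqRHS]big_mkcond /=; apply: leq_sum => h _.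
    rewrite /few -ltnNge; case: (partial_proper e h) => //=; case: ifP => // _.
    exact: max_card.
  by rewrite sum_nat_cond_const mulnC.
(* The terms of [r] with three or more holes total at most [C * B], less than the gain [G]; those of
   [r'] are bounded below by 0. *)
apply: leq_ltn_trans (leq_add (leqnn _) le_many) _.
apply: leq_trans (leq_trans le_few (leq_addr _ _)).
by rewrite ltn_add2l.
Qed.
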